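(* There is no algorithm which, given (a description of) a consistent recursively enumerable theory $T\supseteq\mathsf{Q}$, computes the number $\mathsf{b}_T$.
   Context: Formulas of arithmetic are Gödel-coded in a standard way. Variables are $x,x',x'',x''',\dots$, of lengths $1,2,3,4,\dots$ respectively. The length of a formula (or of its code) is denoted $\mathsf{len}$, and for each $k$ there are finitely many formulas of length $k$. The numeral $\overline{m}=\mathsf{s}(\cdots\mathsf{s}(0)\cdots)$, with $m$ occurrences of $\mathsf{s}$, has length $3m+1$. For a recursively enumerable theory $T$, $\mathsf{Pr}_T(x)$ is its standard provability predicate. For a formula $\psi(x_1,\dots,x_m)$ with $m\geqslant 0$ free variables and a number $n$, ${\sf D}(\psi,n)$ is the Gödel code of the formula $\forall x[\psi(x,\dots,x)\leftrightarrow x=\overline{n}]$. This operation is formalized as a function ${\sf D}(x,y)$ in arithmetic. Define the following formulas: - $\mathsf{Def}_T^{<z}(y)$ is $\exists x[\mathsf{len}(x)<z\wedge\mathsf{Pr}_T({\sf D}(x,y))]$. - $\mathsf{Berry}_T^{<v}(u)$ is $\neg\mathsf{Def}_T^{<v}(u)\wedge\forall y<u\,\mathsf{Def}_T^{<v}(y)$. Let $\ell_T$ be the length of the formula $\mathsf{Berry}_T^{<x'}(x)$. Finally, $\mathsf{b}_T$ is the least number $n$ such that there is no formula $\psi$ with $\mathsf{len}(\psi)<5\ell_T$ and $T\vdash\forall x[\psi(x,\dots,x)\leftrightarrow x=\overline{n}]$. In other words, $\mathsf{b}_T$ is the least number not definable in $T$ by a formula of length less than $5\ell_T$. $\mathsf{Q}$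 is Robinson's arithmetic. *)

(* Defs.v *)
From Stdlib Require Import Arith List Cantor.
Import ListNotations.

Notation "⟨ a , b ⟩" := (Cantor.to_nat (a, b)) (at level 0).

(** * Algorithms *)

(** Partial recursive functions of one argument; several arguments are packed
    with the Cantor pairing. *)
Inductive prog : Set :=
| PZero : prog
| PSucc : prog
| PFst : prog
| PSnd : prog
| PPair : prog -> prog -> prog
| PComp : prog -> prog -> prog
| PRec : prog -> prog -> prog
| PMu : prog -> prog.

(** [eval f x y]: the program [f] halts on input [x] with output [y]. *)
Inductive eval : prog -> nat -> nat -> Prop :=
| ev_zero x : eval PZero x 0
| ev_succ x : eval PSucc x (S x)
| ev_fst a b : eval PFst ⟨a, b⟩ a
| ev_snd a b : eval PSnd ⟨a, b⟩ b
| ev_pair f g x a b :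
    eval f x a -> eval g x b -> eval (PPair f g) x ⟨a, b⟩
| ev_comp f g x a y :
    eval g x a -> eval f a y -> eval (PComp f g) x y
| ev_rec0 f g a y :
    eval f a y -> eval (PRec f g) ⟨a, 0⟩ y
| ev_recS f g a n u y :
    eval (PRec f g) ⟨a, n⟩ u -> eval g ⟨a, ⟨n, u⟩⟩ y ->
    eval (PRec f g) ⟨a, S n⟩ y
| ev_mu f x n (w : nat -> nat) :
    (forall i, i < n -> eval f ⟨x, i⟩ (S (w i))) -> eval f ⟨x, n⟩ 0 ->
    eval (PMu f) x n.

Fixpoint prog_code (f : prog) : nat :=
  match f with
  | PZero => ⟨0, 0⟩
  | PSucc => ⟨1, 0⟩
  | PFst => ⟨2, 0⟩
  | PSnd => ⟨3, 0⟩
  | PPair f g => ⟨4, ⟨prog_code f, prog_code g⟩⟩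
  | PComp f g => ⟨5, ⟨prog_code f, prog_code g⟩⟩
  | PRec f g => ⟨6, ⟨prog_code f, prog_code g⟩⟩
  | PMu f => ⟨7, prog_code f⟩
  end.

(** * First-order arithmetic *)

(** [Var k] is the variable [x] followed by [k] primes. *)
Inductive term : Set :=
| Var : nat -> term
| Zero : term
| Succ : term -> term
| Plus : term -> term -> term
| Mult : term -> term -> term.

Inductive form : Set :=
| Eq : term -> term -> form
| Neg : form -> form
| Imp : form -> form -> form
| All : nat -> form -> form.

Definition And (a b : form) : form := Neg (Imp a (Neg b)).
Definition Or (a b : form) : form := Imp (Neg a) b.
Definition Iff (a b : form) : form := And (Imp a b) (Imp b a).
Definition Ex (k : nat) (a : form) : form := Neg (All k (Neg a)).

Fixpoint num (n : nat) : term :=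
  match n with 0 => Zero | S n => Succ (num n) end.

(** Number of symbols, terms and formulas being spelled
    [s(t)], [(t+u)], [(t.u)], [t=u], [¬a], [(a→b)], [∀xa]. *)
Fixpoint term_len (t : term) : nat :=
  match t with
  | Var k => k + 1
  | Zero => 1
  | Succ t => term_len t + 3
  | Plus t u | Mult t u => term_len t + term_len u + 3
  end.

Fixpoint len (a : form) : nat :=
  match a with
  | Eq t u => term_len t + term_len u + 1
  | Neg a => len a + 1
  | Imp a b => len a + len b + 3
  | All k a => 1 + term_len (Var k) + len a
  end.

Fixpoint term_code (t : term) : nat :=
  match t with
  | Var k => ⟨0, k⟩
  | Zero => ⟨1, 0⟩
  | Succ t => ⟨2, term_code t⟩
  | Plus t u => ⟨3, ⟨term_code t, term_code u⟩⟩
  | Mult t u => ⟨4, ⟨term_code t, term_code u⟩⟩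
  end.

Fixpoint form_code (a : form) : nat :=
  match a with
  | Eq t u => ⟨0, ⟨term_code t, term_code u⟩⟩
  | Neg a => ⟨1, form_code a⟩
  | Imp a b => ⟨2, ⟨form_code a, form_code b⟩⟩
  | All k a => ⟨3, ⟨k, form_code a⟩⟩
  end.

Fixpoint occurs (v : nat) (t : term) : Prop :=
  match t with
  | Var k => k = v
  | Zero => False
  | Succ t => occurs v t
  | Plus t u | Mult t u => occurs v t \/ occurs v u
  end.

Fixpoint free (v : nat) (a : form) : Prop :=
  match a with
  | Eq t u => occurs v t \/ occurs v u
  | Neg a => free v a
  | Imp a b => free v a \/ free v b
  | All k a => k <> v /\ free v a
  end.

Definition sentence (a : form) : Prop := forall v, ~ free v a.

Fixpoint term_subst (v : nat) (s t : term) : term :=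
  match t with
  | Var k => if Nat.eqb k v then s else Var k
  | Zero => Zero
  | Succ t => Succ (term_subst v s t)
  | Plus t u => Plus (term_subst v s t) (term_subst v s u)
  | Mult t u => Mult (term_subst v s t) (term_subst v s u)
  end.

Fixpoint subst (v : nat) (s : term) (a : form) : form :=
  match a with
  | Eq t u => Eq (term_subst v s t) (term_subst v s u)
  | Neg a => Neg (subst v s a)
  | Imp a b => Imp (subst v s a) (subst v s b)
  | All k a => All k (if Nat.eqb k v then a else subst v s a)
  end.

(** [s] is free for the variable [v] in the formula. *)
Fixpoint free_for (v : nat) (s : term) (a : form) : Prop :=
  match a with
  | Eq _ _ => True
  | Neg a => free_for v s a
  | Imp a b => free_for v s a /\ free_for v s b
  | All k a => ~ free v (All k a) \/ (~ occurs k s /\ free_for v s a)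
  end.

Definition theory := form -> Prop.

(** Mendelson's Hilbert calculus for first-order logic with equality. *)
Inductive prv (T : theory) : form -> Prop :=
| prv_ax a : T a -> prv T a
| prv_A1 a b : prv T (Imp a (Imp b a))
| prv_A2 a b c :
    prv T (Imp (Imp a (Imp b c)) (Imp (Imp a b) (Imp a c)))
| prv_A3 a b :
    prv T (Imp (Imp (Neg b) (Neg a)) (Imp (Imp (Neg b) a) b))
| prv_A4 v s a : free_for v s a -> prv T (Imp (All v a) (subst v s a))
| prv_A5 v a b :
    ~ free v a -> prv T (Imp (All v (Imp a b)) (Imp a (All v b)))
| prv_A6 v : prv T (Eq (Var v) (Var v))
| prv_A7 v w a :
    free_for v (Var w) a ->
    prv T (Imp (Eq (Var v) (Var w)) (Imp a (subst v (Var w) a)))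
| prv_MP a b : prv T (Imp a b) -> prv T a -> prv T b
| prv_Gen v a : prv T a -> prv T (All v a).

Definition consistent (T : theory) : Prop :=
  ~ exists a, prv T a /\ prv T (Neg a).

Inductive robinson_Q : theory :=
| Q1 : robinson_Q (All 0 (All 1
    (Imp (Eq (Succ (Var 0)) (Succ (Var 1))) (Eq (Var 0) (Var 1)))))
| Q2 : robinson_Q (All 0 (Neg (Eq (Succ (Var 0)) Zero)))
| Q3 : robinson_Q (All 0
    (Imp (Neg (Eq (Var 0) Zero)) (Ex 1 (Eq (Var 0) (Succ (Var 1))))))
| Q4 : robinson_Q (All 0 (Eq (Plus (Var 0) Zero) (Var 0)))
| Q5 : robinson_Q (All 0 (All 1
    (Eq (Plus (Var 0) (Succ (Var 1))) (Succ (Plus (Var 0) (Var 1))))))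
| Q6 : robinson_Q (All 0 (Eq (Mult (Var 0) Zero) Zero))
| Q7 : robinson_Q (All 0 (All 1
    (Eq (Mult (Var 0) (Succ (Var 1)))
        (Plus (Mult (Var 0) (Var 1)) (Var 0))))).

(** [collapse [] psi] is ψ(x,...,x): every free variable is replaced by
    [x = Var 0]. To avoid capture each bound variable [Var k] is renamed to
    [Var (S k)]; [B] lists the variables bound at the current position. *)
Fixpoint term_collapse (B : list nat) (t : term) : term :=
  match t with
  | Var k => if existsb (Nat.eqb k) B then Var (S k) else Var 0
  | Zero => Zero
  | Succ t => Succ (term_collapse B t)
  | Plus t u => Plus (term_collapse B t) (term_collapse B u)
  | Mult t u => Mult (term_collapse B t) (term_collapse B u)
  end.

Fixpoint collapse (B : list nat) (a : form) : form :=
  match a with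
  | Eq t u => Eq (term_collapse B t) (term_collapse B u)
  | Neg a => Neg (collapse B a)
  | Imp a b => Imp (collapse B a) (collapse B b)
  | All k a => All (S k) (collapse (k :: B) a)
  end.

(** ∀x [ψ(x,...,x) ↔ x = n̄]; its code is D(ψ, n). *)
Definition defining_sentence (psi : form) (n : nat) : form :=
  All 0 (Iff (collapse [] psi) (Eq (Var 0) (num n))).

(** * Writing formulas of arithmetic *)

(** A [scoped] is a formula awaiting the index from which variables are still
    unused; quantifiers bind the first such variable, so that no capture
    occurs. *)
Definition scoped := nat -> form.

Definition s_eq (t u : term) : scoped := fun _ => Eq t u.
Definition s_neg (p : scoped) : scoped := fun k => Neg (p k).
Definition s_and (p q : scoped) : scoped := fun k => And (p k) (q k).
Definition s_or (p q : scoped) : scoped := fun k => Or (p k) (q k).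
Definition s_imp (p q : scoped) : scoped := fun k => Imp (p k) (q k).
Definition s_ex (p : term -> scoped) : scoped :=
  fun k => Ex k (p (Var k) (S k)).
Definition s_all (p : term -> scoped) : scoped :=
  fun k => All k (p (Var k) (S k)).

Declare Scope arith_scope.
Delimit Scope arith_scope with A.
Bind Scope arith_scope with scoped.
Notation "t == u" := (s_eq t u) (at level 70) : arith_scope.
Notation "t != u" := (s_neg (s_eq t u)) (at level 70) : arith_scope.
Notation "~ p" := (s_neg p) : arith_scope.
Notation "p /\ q" := (s_and p q) : arith_scope.
Notation "p \/ q" := (s_or p q) : arith_scope.
Notation "p -> q" := (s_imp p q) : arith_scope.
Notation "∃ x .. y , p" := (s_ex (fun x => .. (s_ex (fun y => p%A)) ..))
  (at level 200, x binder, y binder, right associativity) : arith_scope.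
Notation "∀ x .. y , p" := (s_all (fun x => .. (s_all (fun y => p%A)) ..))
  (at level 200, x binder, y binder, right associativity) : arith_scope.

Definition s_lt (t u : term) : scoped := (∃ z, Plus z (Succ t) == u)%A.
Notation "t < u" := (s_lt t u) : arith_scope.

Definition s_ex_lt (u : term) (p : term -> scoped) : scoped :=
  (∃ i, i < u /\ p i)%A.
Definition s_all_lt (u : term) (p : term -> scoped) : scoped :=
  (∀ i, i < u -> p i)%A.
Notation "∃[ i < u ] p" := (s_ex_lt u (fun i => p%A))
  (at level 200, i name, u at level 69, p at level 200, right associativity) : arith_scope.
Notation "∀[ i < u ] p" := (s_all_lt u (fun i => p%A))
  (at level 200, i name, u at level 69, p at level 200, right associativity) : arith_scope.

(** The graph of the Cantor pairing, see [Cantor.to_nat_spec]. *)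
Definition s_pair (a b z : term) : scoped :=
  s_eq (Plus z z)
       (Plus (Plus b b) (Mult (Plus b a) (Succ (Plus b a)))).

(** Nested pairs, and the formula stating that [z] is such a pair. *)
Inductive pat : Set :=
| PT : term -> pat
| PP : pat -> pat -> pat.
Coercion PT : term >-> pat.

Fixpoint s_is (z : term) (p : pat) : scoped :=
  match p with
  | PT t => (z == t)%A
  | PP p q => (∃ a b, s_is a p /\ s_is b q /\ s_pair a b z)%A
  end.
Notation "z ≐ p" := (s_is z p) (at level 70) : arith_scope.
Notation "⟪ p , q ⟫" := (PP p q) (at level 0).

(** Gödel's β: [z] is the remainder of [c] modulo [1 + (i + 1) d]. *)
Definition s_beta (c d i z : term) : scoped :=
  (z < Succ (Mult d (Succ i)) /\
   ∃ q, c == Plus (Mult q (Succ (Mult d (Succ i)))) z)%A.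

(** [p] occurs in a finite sequence each entry [z] of which satisfies
    [R m z], where [m w] states that [w] occurs before [z] in it. *)
Definition s_derivable (R : (pat -> scoped) -> term -> scoped) (p : pat)
  : scoped :=
  (∃ c d n,
    (∃[i < n] ∃ z, s_beta c d i z /\ z ≐ p) /\
    ∀[i < n] ∃ z, s_beta c d i z /\
      R (fun w => ∃[j < i] ∃ y, s_beta c d j y /\ y ≐ w)%A z)%A.

(** * Arithmetization of syntax *)

Definition cVar (k : pat) : pat := ⟪num 0, k⟫.
Definition cZero : pat := ⟪num 1, num 0⟫.
Definition cSucc (t : pat) : pat := ⟪num 2, t⟫.
Definition cPlus (t u : pat) : pat := ⟪num 3, ⟪t, u⟫⟫.
Definition cMult (t u : pat) : pat := ⟪num 4, ⟪t, u⟫⟫.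
Definition cEq (t u : pat) : pat := ⟪num 0, ⟪t, u⟫⟫.
Definition cNeg (a : pat) : pat := ⟪num 1, a⟫.
Definition cImp (a b : pat) : pat := ⟪num 2, ⟪a, b⟫⟫.
Definition cAll (k a : pat) : pat := ⟪num 3, ⟪k, a⟫⟫.
Definition cAnd (a b : pat) : pat := cNeg (cImp a (cNeg b)).
Definition cIff (a b : pat) : pat := cAnd (cImp a b) (cImp b a).
Definition cNil : pat := ⟪num 0, num 0⟫.
Definition cCons (h l : pat) : pat := ⟪num 1, ⟪h, l⟫⟫.

Definition s_term : pat -> scoped :=
  s_derivable (fun m z =>
    (∃ k, z ≐ cVar k) \/ z ≐ cZero \/ (∃ t, m t /\ z ≐ cSucc t) \/
    (∃ t u, m t /\ m u /\ (z ≐ cPlus t u \/ z ≐ cMult t u)))%A.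

Definition s_form : pat -> scoped :=
  s_derivable (fun m z =>
    (∃ t u, s_term t /\ s_term u /\ z ≐ cEq t u) \/
    (∃ a, m a /\ z ≐ cNeg a) \/ (∃ a b, m a /\ m b /\ z ≐ cImp a b) \/
    (∃ k a, m a /\ z ≐ cAll k a))%A.

(** [v] does not occur in a term, does not occur free in a formula. *)
Definition s_not_occurs (v : term) : pat -> scoped :=
  s_derivable (fun m z =>
    (∃ k, k != v /\ z ≐ cVar k) \/ z ≐ cZero \/
    (∃ t, m t /\ z ≐ cSucc t) \/
    (∃ t u, m t /\ m u /\ (z ≐ cPlus t u \/ z ≐ cMult t u)))%A.

Definition s_not_free (v : term) : pat -> scoped :=
  s_derivable (fun m z =>
    (∃ t u, s_not_occurs v t /\ s_not_occurs v u /\ z ≐ cEq t u) \/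
    (∃ a, m a /\ z ≐ cNeg a) \/ (∃ a b, m a /\ m b /\ z ≐ cImp a b) \/
    (∃ k a, (m a \/ (k == v /\ s_form a)) /\ z ≐ cAll k a))%A.

(** Pairs [⟪t, t'⟫] where [t'] is [t] with [s] for [v]. *)
Definition s_term_subst (v s : term) : pat -> scoped :=
  s_derivable (fun m z =>
    z ≐ ⟪cVar v, s⟫ \/
    (∃ k, k != v /\ z ≐ ⟪cVar k, cVar k⟫) \/
    z ≐ ⟪cZero, cZero⟫ \/
    (∃ t t', m ⟪t, t'⟫ /\ z ≐ ⟪cSucc t, cSucc t'⟫) \/
    (∃ t t' u u', m ⟪t, t'⟫ /\ m ⟪u, u'⟫ /\
      (z ≐ ⟪cPlus t u, cPlus t' u'⟫ \/ z ≐ ⟪cMult t u, cMult t' u'⟫)))%A.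

(** Pairs [⟪a, a'⟫] where [a'] is [a] with [s] for [v], and [s] is free for
    [v] in [a]. *)
Definition s_subst (v s : term) : pat -> scoped :=
  s_derivable (fun m z =>
    (∃ t t' u u', s_term_subst v s ⟪t, t'⟫ /\ s_term_subst v s ⟪u, u'⟫ /\
      z ≐ ⟪cEq t u, cEq t' u'⟫) \/
    (∃ a a', m ⟪a, a'⟫ /\ z ≐ ⟪cNeg a, cNeg a'⟫) \/
    (∃ a a' b b', m ⟪a, a'⟫ /\ m ⟪b, b'⟫ /\
      z ≐ ⟪cImp a b, cImp a' b'⟫) \/
    (∃ k a, s_not_free v (cAll k a) /\ z ≐ ⟪cAll k a, cAll k a⟫) \/
    (∃ k a a', k != v /\ s_not_occurs k s /\ m ⟪a, a'⟫ /\
      z ≐ ⟪cAll k a, cAll k a'⟫))%A.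

Definition s_logical_axiom (z : term) : scoped :=
  (s_form z /\
   ((∃ a b, z ≐ cImp a (cImp b a)) \/
    (∃ a b c, z ≐ cImp (cImp a (cImp b c)) (cImp (cImp a b) (cImp a c))) \/
    (∃ a b, z ≐ cImp (cImp (cNeg b) (cNeg a)) (cImp (cImp (cNeg b) a) b)) \/
    (∃ v s a a', s_term s /\ s_subst v s ⟪a, a'⟫ /\
      z ≐ cImp (cAll v a) a') \/
    (∃ v a b, s_not_free v a /\
      z ≐ cImp (cAll v (cImp a b)) (cImp a (cAll v b))) \/
    (∃ v, z ≐ cEq (cVar v) (cVar v)) \/
    (∃ v w s a a', s ≐ cVar w /\ s_subst v s ⟪a, a'⟫ /\
      z ≐ cImp (cEq (cVar v) (cVar w)) (cImp a a'))))%A.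

(** The graph of the partial recursive function [f]. *)
Fixpoint s_eval (f : prog) (x y : term) : scoped :=
  match f with
  | PZero => (y == Zero)%A
  | PSucc => (y == Succ x)%A
  | PFst => (∃ b, x ≐ ⟪y, b⟫)%A
  | PSnd => (∃ a, x ≐ ⟪a, y⟫)%A
  | PPair f g => (∃ a b, s_eval f x a /\ s_eval g x b /\ y ≐ ⟪a, b⟫)%A
  | PComp f g => (∃ a, s_eval g x a /\ s_eval f a y)%A
  | PRec f g =>
      (∃ a n c d, x ≐ ⟪a, n⟫ /\
        (∃ u, s_beta c d Zero u /\ s_eval f a u) /\
        (∀[i < n] ∃ u w v, s_beta c d i u /\ s_beta c d (Succ i) w /\
          v ≐ ⟪a, ⟪i, u⟫⟫ /\ s_eval g v w) /\
        s_beta c d n y)%A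
  | PMu f =>
      ((∃ v, v ≐ ⟪x, y⟫ /\ s_eval f v Zero) /\
       ∀[i < y] ∃ v w, v ≐ ⟪x, i⟫ /\ s_eval f v (Succ w))%A
  end.

(** Provability from the axioms enumerated by [e]. *)
Definition s_Pr (e : prog) : pat -> scoped :=
  s_derivable (fun m z =>
    (∃ i, s_eval e i z) \/ s_logical_axiom z \/
    (∃ a, m (cImp a z) /\ m a) \/ (∃ v a, m a /\ z ≐ cAll v a))%A.

Definition s_member (k : term) : pat -> scoped :=
  s_derivable (fun m z => ∃ h l, (h == k \/ m l) /\ z ≐ cCons h l)%A.

Definition s_not_member (k : term) : pat -> scoped :=
  s_derivable (fun m z =>
    z ≐ cNil \/ (∃ h l, h != k /\ m l /\ z ≐ cCons h l))%A.

(** The graphs of [term_collapse B] and of [collapse]. *)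
Definition s_term_collapse (B : term) : pat -> scoped :=
  s_derivable (fun m z =>
    (∃ k, s_member k B /\ z ≐ ⟪cVar k, cVar (Succ k)⟫) \/
    (∃ k, s_not_member k B /\ z ≐ ⟪cVar k, cVar Zero⟫) \/
    z ≐ ⟪cZero, cZero⟫ \/
    (∃ t t', m ⟪t, t'⟫ /\ z ≐ ⟪cSucc t, cSucc t'⟫) \/
    (∃ t t' u u', m ⟪t, t'⟫ /\ m ⟪u, u'⟫ /\
      (z ≐ ⟪cPlus t u, cPlus t' u'⟫ \/ z ≐ ⟪cMult t u, cMult t' u'⟫)))%A.

Definition s_collapse : pat -> scoped :=
  s_derivable (fun m z =>
    (∃ B t t' u u',
      s_term_collapse B ⟪t, t'⟫ /\ s_term_collapse B ⟪u, u'⟫ /\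
      z ≐ ⟪B, ⟪cEq t u, cEq t' u'⟫⟫) \/
    (∃ B a a', m ⟪B, ⟪a, a'⟫⟫ /\ z ≐ ⟪B, ⟪cNeg a, cNeg a'⟫⟫) \/
    (∃ B a a' b b', m ⟪B, ⟪a, a'⟫⟫ /\ m ⟪B, ⟪b, b'⟫⟫ /\
      z ≐ ⟪B, ⟪cImp a b, cImp a' b'⟫⟫) \/
    (∃ B k a a', m ⟪cCons k B, ⟪a, a'⟫⟫ /\
      z ≐ ⟪B, ⟪cAll k a, cAll (Succ k) a'⟫⟫))%A.

(** Pairs of a number and the code of its numeral. *)
Definition s_num_code : pat -> scoped :=
  s_derivable (fun m z =>
    z ≐ ⟪Zero, cZero⟫ \/
    (∃ n t, m ⟪n, t⟫ /\ z ≐ ⟪Succ n, cSucc t⟫))%A.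

(** [z] is the code of [defining_sentence psi y], with [x] the code of
    [psi]. *)
Definition s_D (x y z : term) : scoped :=
  (∃ a t, s_collapse ⟪cNil, ⟪x, a⟫⟫ /\ s_num_code ⟪y, t⟫ /\
    z ≐ cAll Zero (cIff a (cEq (cVar Zero) t)))%A.

(** Pairs of the code of a term or formula and its length. *)
Definition s_term_len : pat -> scoped :=
  s_derivable (fun m z =>
    (∃ k, z ≐ ⟪cVar k, Plus k (num 1)⟫) \/
    z ≐ ⟪cZero, num 1⟫ \/
    (∃ t n, m ⟪t, n⟫ /\ z ≐ ⟪cSucc t, Plus n (num 3)⟫) \/
    (∃ t n u p, m ⟪t, n⟫ /\ m ⟪u, p⟫ /\
      (z ≐ ⟪cPlus t u, Plus (Plus n p) (num 3)⟫ \/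
       z ≐ ⟪cMult t u, Plus (Plus n p) (num 3)⟫)))%A.

Definition s_len : pat -> scoped :=
  s_derivable (fun m z =>
    (∃ t n u p, s_term_len ⟪t, n⟫ /\ s_term_len ⟪u, p⟫ /\
      z ≐ ⟪cEq t u, Plus (Plus n p) (num 1)⟫) \/
    (∃ a n, m ⟪a, n⟫ /\ z ≐ ⟪cNeg a, Plus n (num 1)⟫) \/
    (∃ a n b p, m ⟪a, n⟫ /\ m ⟪b, p⟫ /\
      z ≐ ⟪cImp a b, Plus (Plus n p) (num 3)⟫) \/
    (∃ k a n, m ⟪a, n⟫ /\
      z ≐ ⟪cAll k a, Plus (Plus (num 1) (Plus k (num 1))) n⟫))%A.

(** * Berry's formula and the number b *)

(** Def_T^{<z}(y), for the theory enumerated by [e]. *)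
Definition s_Def (e : prog) (z y : term) : scoped :=
  (∃ x, (∃ n, s_len ⟪x, n⟫ /\ n < z) /\ ∃ w, s_D x y w /\ s_Pr e w)%A.

(** Berry_T^{<v}(u). *)
Definition s_Berry (e : prog) (v u : term) : scoped :=
  (~ s_Def e v u /\ ∀[y < u] s_Def e v y)%A.

(** The formula Berry_T^{<x'}(x); variables from [Var 2] on are unused. *)
Definition Berry (e : prog) : form := s_Berry e (Var 1) (Var 0) 2.

Definition ell (e : prog) : nat := len (Berry e).

(** [T] is the recursively enumerable theory described by [e]: the outputs of
    [e] are exactly the codes of the elements of [T]. *)
Definition enumerates (e : prog) (T : theory) : Prop :=
  forall m, (exists i, eval e i m) <-> (exists a, T a /\ m = form_code a).

Definition definable_below (T : theory) (k n : nat) : Prop :=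
  exists psi, len psi < k /\ prv T (defining_sentence psi n).

(** [b] is b_T, for [T] described by [e]. *)
Definition berry_number (e : prog) (T : theory) (b : nat) : Prop :=
  ~ definable_below T (5 * ell e) b /\
  forall n, n < b -> definable_below T (5 * ell e) n.

(* Main.v *)
(** Robinson's [Q] does not decide products [0 * a] with [S a = a]: the natural
    numbers extended by one point [a] at infinity form a model in which [0 * a]
    may be any number [n], and there the formula [∃y (S y = y ∧ 0 * y = x)]
    defines exactly [n]. If an algorithm computed b_T, then by the recursion
    theorem some theory [T] would consist of [Q] and of the axiom stating that
    this short formula defines the very number b that the algorithm returns on
    [T]. As [T] is consistent, b is b_T, yet it is defined in [T] by a formula
    of length below [5 * ell]. *)
From Stdlib Require Import Arith List Lia Cantor Classical.
Require Import Defs.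
Import ListNotations.

(** Reducing unary codes of formulas or programs does not terminate in
    practice. *)
Local Opaque Cantor.to_nat.

Lemma pair_inj a b c d : ⟨a, b⟩ = ⟨c, d⟩ -> a = c /\ b = d.
Proof. intros H. apply Cantor.to_nat_inj in H. now injection H. Qed.

Ltac split_pairs :=
  repeat match goal with
  | H : ⟨_, _⟩ = ⟨_, _⟩ |- _ => apply pair_inj in H; destruct H; subst
  end.

(** * Programs *)

Lemma eval_rec_inv f g a n z :
  eval (PRec f g) ⟨a, n⟩ z ->
  match n with
  | 0 => eval f a z
  | S m => exists u, eval (PRec f g) ⟨a, m⟩ u /\ eval g ⟨a, ⟨m, u⟩⟩ z
  end.
Proof.
  remember ⟨a, n⟩ as x eqn:Hx. intros H.
  inversion H; subst; split_pairs; eauto.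
Qed.

Lemma eval_functional f x y z : eval f x y -> eval f x z -> y = z.
Proof.
  intros H. revert z.
  induction H as [| | | | f g x a b _ IHf _ IHg | f g x a y _ IHg _ IHf
    | f g a y _ IHf | f g a n u y _ IHr _ IHg | f x n w _ IHlt _ IHn];
    intros z Hz;
    try (apply eval_rec_inv in Hz); try (inversion Hz; subst; split_pairs; easy).
  - inversion Hz; subst. f_equal. f_equal; auto.
  - inversion Hz; subst. apply IHf.
    match goal with H : eval g _ _ |- _ => now rewrite (IHg _ H) end.
  - now apply IHf.
  - destruct Hz as [u' [Hu' Hz]]. apply IHr in Hu'. subst. now apply IHg.
  - inversion Hz; subst.
    (* If the two minima differed, then at the smaller one [f] would return both zero and a
       successor. *)
    destruct (Nat.lt_trichotomy n z) as [Hlt | [-> | Hlt]]; [| reflexivity |].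
    + match goal with H : forall i, i < z -> _ |- _ =>
        specialize (H n Hlt); now apply IHn in H end.
    + match goal with H : eval f ⟨x, z⟩ 0 |- _ =>
        now apply (IHlt z Hlt) in H end.
Qed.

Definition PId : prog := PPair PFst PSnd.

Lemma eval_id x : eval PId x x.
Proof.
  rewrite <- (Cantor.cancel_to_of x). destruct (Cantor.of_nat x).
  apply ev_pair; constructor.
Qed.

Fixpoint PConst (n : nat) : prog :=
  match n with 0 => PZero | S n => PComp PSucc (PConst n) end.

Lemma eval_const n x : eval (PConst n) x n.
Proof.
  induction n as [| n IH]; [apply ev_zero |].
  apply ev_comp with n; [exact IH | apply ev_succ].
Qed.

(** The parameter of the recursion is a dummy [0]; the two [PSnd] make [g] see only the previous
    value. *)
Definition PIter (a : nat) (g : prog) : prog :=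
  PComp (PRec (PConst a) (PComp g (PComp PSnd PSnd))) (PPair PZero PId).

Lemma eval_iter (F : nat -> nat) g n :
  (forall k, eval g (F k) (F (S k))) -> eval (PIter (F 0) g) n (F n).
Proof.
  intros Hg. apply ev_comp with ⟨0, n⟩.
  - apply ev_pair; [apply ev_zero | apply eval_id].
  - induction n as [| n IH]; [apply ev_rec0, eval_const |].
    apply ev_recS with (F n); [exact IH |].
    apply ev_comp with (F n); [| apply Hg].
    apply ev_comp with ⟨n, F n⟩; apply ev_snd.
Qed.

Definition PTag (k : nat) (p : prog) : prog := PPair (PConst k) p.

Lemma eval_tag k p x y : eval p x y -> eval (PTag k p) x ⟨k, y⟩.
Proof. intros H. apply ev_pair; [apply eval_const | exact H]. Qed.

(** [specialize f c] is the program [i ↦ f ⟨c, i⟩]. *)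
Definition specialize (f : prog) (c : nat) : prog :=
  PComp f (PPair (PConst c) PId).

Lemma eval_specialize f c i y : eval (specialize f c) i y <-> eval f ⟨c, i⟩ y.
Proof.
  assert (Hpair : eval (PPair (PConst c) PId) i ⟨c, i⟩)
    by (apply ev_pair; [apply eval_const | apply eval_id]).
  split; intros H.
  - inversion H; subst.
    match goal with H : eval (PPair _ _) _ _ |- _ =>
      rewrite (eval_functional _ _ _ _ Hpair H) end.
    assumption.
  - now apply ev_comp with ⟨c, i⟩.
Qed.

(** On the code [c] of a program [f], the code of [specialize f c]. *)
Definition PDiag : prog :=
  PTag 5 (PPair PId (PTag 4 (PPair
    (PIter (prog_code PZero) (PTag 5 (PTag (prog_code PSucc) PId)))
    (PConst (prog_code PId))))).

Lemma eval_diag f :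
  eval PDiag (prog_code f) (prog_code (specialize f (prog_code f))).
Proof.
  set (c := prog_code f).
  change (prog_code (specialize f c))
    with ⟨5, ⟨c, ⟨4, ⟨prog_code (PConst c), prog_code PId⟩⟩⟩⟩.
  (* Here [c] plays two roles: as the code of [f] it is copied, while as a constant it is turned
     into the code of [PConst c] by [c] iterations. *)
  apply eval_tag, ev_pair; [apply eval_id |].
  apply eval_tag, ev_pair; [| apply eval_const].
  apply (eval_iter (fun n => prog_code (PConst n))). intros k.
  apply eval_tag, eval_tag, eval_id.
Qed.

Theorem recursion_theorem (h : prog) :
  exists e, forall i y, eval e i y <-> eval h ⟨prog_code e, i⟩ y.
Proof.
  (* Kleene's diagonalization: on [⟨c, i⟩] with [c] the code of [f], [q] passes to [h] the code of
     [specialize f c]. For [f = q] this is the code of the very program chosen next. *)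
  set (q := PComp h (PPair (PComp PDiag PFst) PSnd)).
  exists (specialize q (prog_code q)). intros i y.
  rewrite eval_specialize. set (e := specialize q (prog_code q)).
  assert (Harg : eval (PPair (PComp PDiag PFst) PSnd)
                   ⟨prog_code q, i⟩ ⟨prog_code e, i⟩).
  { apply ev_pair; [| apply ev_snd].
    apply ev_comp with (prog_code q); [apply ev_fst | apply eval_diag]. }
  split; intros H.
  - inversion H; subst.
    match goal with H : eval (PPair _ _) _ _ |- _ =>
      rewrite (eval_functional _ _ _ _ Harg H) end.
    assumption.
  - now apply ev_comp with ⟨prog_code e, i⟩.
Qed.

(** On [⟨a, i⟩]: the [i]-th entry of the list, or [p a] beyond its end. The
    entries of the list are computed whether or not [p] halts on [a]. *)
Fixpoint PTable (l : list nat) (p : prog) : prog :=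
  match l with
  | [] => PComp p PFst
  | x :: l =>
      PRec (PConst x) (PComp (PTable l p) (PPair PFst (PComp PFst PSnd)))
  end.

Lemma eval_forget_rec a n u :
  eval (PPair PFst (PComp PFst PSnd)) ⟨a, ⟨n, u⟩⟩ ⟨a, n⟩.
Proof.
  apply ev_pair; [apply ev_fst |].
  apply ev_comp with ⟨n, u⟩; [apply ev_snd | apply ev_fst].
Qed.

Lemma eval_table_sound l p a i y :
  eval (PTable l p) ⟨a, i⟩ y -> In y l \/ eval p a y.
Proof.
  revert i. induction l as [| x l IH]; simpl; intros i H.
  - right. inversion H; subst.
    match goal with H : eval PFst _ _ |- _ =>
      rewrite (eval_functional _ _ _ _ (ev_fst a i) H) end.
    assumption.
  - apply eval_rec_inv in H. destruct i as [| n]; [| destruct H as [u [_ H]]].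
    + left; left. exact (eval_functional _ _ _ _ (eval_const x a) H).
    + inversion H; subst.
      match goal with H : eval (PPair _ _) _ _ |- _ =>
        apply (eval_functional _ _ _ _ (eval_forget_rec a n u)) in H; subst end.
      match goal with H : eval (PTable l p) _ _ |- _ => apply IH in H end.
      tauto.
Qed.

Lemma eval_table_list l p a i :
  i < length l -> eval (PTable l p) ⟨a, i⟩ (nth i l 0).
Proof.
  revert i. induction l as [| x l IH]; simpl; [easy |].
  induction i as [| i IHi]; intros Hi; [apply ev_rec0, eval_const |].
  eapply ev_recS; [apply IHi; lia |].
  eapply ev_comp; [apply eval_forget_rec | apply IH; lia].
Qed.

Lemma eval_table_beyond l p a i y :
  eval p a y -> length l <= i -> eval (PTable l p) ⟨a, i⟩ y.
Proof.
  intros Hy. revert i. induction l as [| x l IH]; simpl; intros i Hi.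
  - apply ev_comp with a; [apply ev_fst | exact Hy].
  - destruct i as [| i]; [lia |].
    (* The step of [PRec] discards the earlier value, but that value must exist for the recursion to
       halt. *)
    assert (Hprev : exists u, eval (PTable (x :: l) p) ⟨a, i⟩ u).
    { clear Hi. induction i as [| i [u Hu]].
      - exists x. apply ev_rec0, eval_const.
      - destruct (le_lt_dec (length l) i) as [Hi | Hi].
        + exists y. eapply ev_recS; [exact Hu |].
          eapply ev_comp; [apply eval_forget_rec | now apply IH].
        + exists (nth i l 0). eapply ev_recS; [exact Hu |].
          eapply ev_comp; [apply eval_forget_rec | now apply eval_table_list]. }
    destruct Hprev as [u Hu].
    eapply ev_recS; [exact Hu |].
    eapply ev_comp; [apply eval_forget_rec | apply IH; lia].
Qed.

(** Halting of [p] on [a] is not assumed: if [p] diverges there, the outputs over all [i] are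
    exactly the list. This enumerates a finite theory with one conditional axiom. *)
Lemma eval_table l p a y :
  (exists i, eval (PTable l p) ⟨a, i⟩ y) <-> In y l \/ eval p a y.
Proof.
  split.
  - intros [i H]. now apply eval_table_sound in H.
  - intros [H | H].
    + apply (In_nth _ _ 0) in H. destruct H as [i [Hi <-]].
      exists i. now apply eval_table_list.
    + exists (length l). now apply eval_table_beyond.
Qed.

(** * The theory *)

Definition inf_form : form :=
  Ex 1 (And (Eq (Succ (Var 1)) (Var 1)) (Eq (Mult Zero (Var 1)) (Var 0))).

Lemma defining_sentence_computable psi :
  exists p, forall n, eval p n (form_code (defining_sentence psi n)).
Proof.
  set (psi_code := PConst (form_code (collapse [] psi))).
  set (num_code := PIter (term_code Zero) (PTag 2 PId)).
  set (eq_code := PTag 0 (PPair (PConst (term_code (Var 0))) num_code)).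
  set (imp_code p q := PTag 2 (PPair p q)).
  (* The outer tags are [All], the variable index [0] and the [Neg] of [And], into which [Iff]
     unfolds. *)
  exists (PTag 3 (PTag 0 (PTag 1 (imp_code (imp_code psi_code eq_code)
            (PTag 1 (imp_code eq_code psi_code)))))).
  intros n.
  assert (Heq : eval eq_code n (form_code (Eq (Var 0) (num n)))).
  { apply eval_tag, ev_pair; [apply eval_const |].
    apply (eval_iter (fun k => term_code (num k))). intros k.
    apply eval_tag, eval_id. }
  assert (Hpsi : eval psi_code n (form_code (collapse [] psi)))
    by apply eval_const.
  apply eval_tag, eval_tag, eval_tag, eval_tag, ev_pair.
  - now apply eval_tag, ev_pair.
  - now apply eval_tag, eval_tag, ev_pair.
Qed.

Lemma robinson_Q_finite : exists l, forall a, robinson_Q a <-> In a l.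
Proof.
  (* The entries are left open, and unification with [Q1] to [Q7] fills them in. *)
  eexists [_; _; _; _; _; _; _]. intros a. split.
  2: { intros [<- | [<- | [<- | [<- | [<- | [<- | [<- | []]]]]]]].
       - exact Q1.
       - exact Q2.
       - exact Q3.
       - exact Q4.
       - exact Q5.
       - exact Q6.
       - exact Q7. }
  intros []; simpl; tauto.
Qed.

Lemma robinson_Q_sentence a : robinson_Q a -> sentence a.
Proof. intros [] v; simpl; tauto. Qed.

Lemma num_closed v n : ~ occurs v (num n).
Proof. now induction n. Qed.

Lemma inf_sentence n : sentence (defining_sentence inf_form n).
Proof. intros v. simpl. generalize (num_closed v n). tauto. Qed.

(** * Soundness of the calculus *)

Record structure := {
  dom : Type;
  izero : dom;
  isucc : dom -> dom;
  iplus : dom -> dom -> dom;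
  imult : dom -> dom -> dom }.

Section Semantics.
Variable M : structure.

Definition upd (r : nat -> dom M) (v : nat) (d : dom M) : nat -> dom M :=
  fun k => if Nat.eqb k v then d else r k.

Fixpoint value (r : nat -> dom M) (t : term) : dom M :=
  match t with
  | Var k => r k
  | Zero => izero M
  | Succ t => isucc M (value r t)
  | Plus t u => iplus M (value r t) (value r u)
  | Mult t u => imult M (value r t) (value r u)
  end.

Fixpoint sat (r : nat -> dom M) (a : form) : Prop :=
  match a with
  | Eq t u => value r t = value r u
  | Neg a => ~ sat r a
  | Imp a b => sat r a -> sat r b
  | All k a => forall d, sat (upd r k d) a
  end.

Definition valid (a : form) : Prop := forall r, sat r a.

Lemma value_ext r r' t :
  (forall k, occurs k t -> r k = r' k) -> value r t = value r' t.
Proof. induction t; simpl; intros H; f_equal; auto. Qed.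

Lemma sat_ext a : forall r r',
  (forall k, free k a -> r k = r' k) -> sat r a <-> sat r' a.
Proof.
  induction a as [t u | a IH | a IHa b IHb | v a IH]; simpl; intros r r' H.
  - now rewrite (value_ext r r' t), (value_ext r r' u) by auto.
  - now rewrite (IH r r').
  - now rewrite (IHa r r'), (IHb r r') by auto.
  - enough (Hd : forall d, sat (upd r v d) a <-> sat (upd r' v d) a)
      by (split; intros Ha d; now apply Hd).
    intros d. apply IH. intros k Hk. unfold upd.
    destruct (Nat.eqb_spec k v); auto.
Qed.

Lemma sat_upd_fresh r v d a : ~ free v a -> sat (upd r v d) a <-> sat r a.
Proof.
  intros Hv. apply sat_ext. intros k Hk. unfold upd.
  now destruct (Nat.eqb_spec k v) as [-> |].
Qed.

Lemma value_subst r v s t :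
  value r (term_subst v s t) = value (upd r v (value r s)) t.
Proof.
  induction t; simpl; f_equal; auto.
  unfold upd. now destruct (Nat.eqb n v).
Qed.

Lemma subst_fresh v s a : ~ free v a -> subst v s a = a.
Proof.
  assert (Ht : forall t, ~ occurs v t -> term_subst v s t = t).
  { induction t as [k | | | |]; simpl; intros H; f_equal; auto.
    now destruct (Nat.eqb_spec k v). }
  induction a as [| | | k]; simpl; intros H; f_equal; auto.
  destruct (Nat.eqb_spec k v); auto.
Qed.

Lemma sat_subst v s a : forall r, free_for v s a ->
  sat r (subst v s a) <-> sat (upd r v (value r s)) a.
Proof.
  induction a as [t u | a IH | a IHa b IHb | k a IH]; intros r H.
  - simpl. now rewrite !value_subst.
  - simpl. now rewrite IH.
  - simpl. now rewrite IHa, IHb by apply H.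
  (* If [v] is not free, neither side changes. Otherwise [free_for] keeps [k] out of [s], so [s]
     retains its value when [k] is updated. *)
  - destruct (classic (free v (All k a))) as [Hv | Hv].
    2: now rewrite subst_fresh, sat_upd_fresh.
    destruct H as [H | [Hk H]]; [easy |]. simpl in Hv |- *.
    destruct (Nat.eqb_spec k v) as [-> | Hkv]; [easy |].
    enough (Hd : forall d, sat (upd r k d) (subst v s a) <->
                           sat (upd (upd r v (value r s)) k d) a)
      by (split; intros Ha d; now apply Hd).
    intros d. rewrite IH by exact H.
    rewrite (value_ext (upd r k d) r s).
    2: { intros j Hj. unfold upd.
         now destruct (Nat.eqb_spec j k) as [-> |]. }
    apply sat_ext. intros j _. unfold upd.
    destruct (Nat.eqb_spec j v), (Nat.eqb_spec j k); congruence.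
Qed.

Lemma soundness (T : theory) :
  (forall a, T a -> valid a) -> forall a, prv T a -> valid a.
Proof.
  intros HT a Ha.
  induction Ha as [a Ha | | | | v s a Hs | v a b Hv | | v w a Hw
    | a b _ IHab _ IHa | v a _ IH]; intros r; simpl.
  - now apply HT.
  - tauto.
  - tauto.
  (* [prv_A3] is valid only classically; [tauto] draws on the loaded classical axiom. *)
  - tauto.
  - intros H. apply sat_subst; auto.
  - intros H Ha d. apply H. now apply sat_upd_fresh.
  - reflexivity.
  - intros E Ha. apply sat_subst; [exact Hw |]. revert Ha.
    apply sat_ext. intros k _. unfold upd. simpl.
    now destruct (Nat.eqb_spec k v) as [-> |].
  - apply IHab, IHa.
  - intros d. apply IH.
Qed.

(** The assignment [r] guarantees an inhabited domain; over an empty one every formula would be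
    vacuously valid. *)
Lemma model_consistent (T : theory) (r : nat -> dom M) :
  (forall a, T a -> valid a) -> consistent T.
Proof.
  intros HT [a [Ha Hna]]. apply (soundness T HT) in Ha, Hna.
  exact (Hna r (Ha r)).
Qed.
End Semantics.

(** * The models *)

(** [None] is the point at infinity, and [b] is its product by zero. *)
Definition inf_model (b : nat) : structure := {|
  dom := option nat;
  izero := Some 0;
  isucc := option_map S;
  iplus x y :=
    match x, y with Some m, Some n => Some (m + n) | _, _ => None end;
  imult x y :=
    match x, y with
    | Some m, Some n => Some (m * n)
    | Some 0, None => Some b
    | None, Some 0 => Some 0
    | _, _ => None
    end |}.

(** The value [b] is unconstrained: [Q6] concerns only a second factor zero, and since [None] is its
    own successor, [Q7] for [0] and [None] merely says [b = b + 0]. *)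
Lemma inf_model_Q b a : robinson_Q a -> valid (inf_model b) a.
Proof.
  intros [] r; simpl; unfold upd; simpl.
  - intros [d |] [d' |]; simpl; congruence.
  - now intros [d |].
  - intros [[| d] |] H; [easy | |]; intros H'.
    + now apply (H' (Some d)).
    + now apply (H' None).
  - intros [d |]; simpl; f_equal; lia.
  - intros [d |] [d' |]; simpl; f_equal; lia.
  - intros [[| d] |]; simpl; f_equal; lia.
  - intros [[| d] |] [[| d'] |]; simpl; f_equal; lia.
Qed.

Lemma value_num b r n : value (inf_model b) r (num n) = Some n.
Proof. induction n as [| n IH]; simpl; [reflexivity | now rewrite IH]. Qed.

Lemma inf_model_defining b :
  valid (inf_model b) (defining_sentence inf_form b).
Proof.
  intros r. simpl. intros d. rewrite value_num. unfold upd. simpl.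
  enough (H : ~ (forall y, ~ ~ (option_map S y = y ->
      match y with Some n => Some 0 | None => Some b end <> d)) <->
      d = Some b) by tauto.
  split.
  (* No finite [y] is its own successor, so only [None] can be the witness, and zero times [None] is
     [b]. *)
  - intros H. apply NNPP. intros Hd. apply H. intros [y |] H'; apply H'.
    + intros E. injection E. lia.
    + intros _ E. now symmetry in E.
  - intros -> H. apply (H None). intros H'. now apply H'.
Qed.

(** [inf_form] has length 26. That [Berry e] is a conjunction already gives it length at least 7, so
    this huge formula is never computed. *)
Lemma len_inf_form e : len inf_form < 5 * ell e.
Proof.
  assert (Hlen : forall a, 1 <= len a) by (induction a; simpl; lia).
  assert (Hand : forall a b, 7 <= len (And a b)).
  { intros a b. generalize (Hlen a) (Hlen b). simpl. lia. }
  assert (Hell : 7 <= ell e) by apply Hand.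
  apply Nat.lt_le_trans with (5 * 7); [simpl; lia |].
  now apply Nat.mul_le_mono_l.
Qed.

Theorem theorem4p5 :
  ~ exists alg : prog,
      forall (e : prog) (T : theory),
        enumerates e T ->
        (forall a, T a -> sentence a) ->
        consistent T ->
        (forall a, robinson_Q a -> T a) ->
        exists b, berry_number e T b /\ eval alg (prog_code e) b.
Proof.
  intros [alg Halg].
  destruct robinson_Q_finite as [l Hl].
  destruct (defining_sentence_computable inf_form) as [ax Hax].
  (* [e] lists the axioms of [Q], then runs [alg] on its own code and turns the output into an
     axiom. *)
  destruct (recursion_theorem (PTable (map form_code l) (PComp ax alg)))
    as [e He].
  (* Halting of [alg] on [e] is known only once [T] satisfies the hypotheses of [Halg], so the last
     axiom is conditional. *)
  set (T := fun a => robinson_Q a \/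
    exists b, eval alg (prog_code e) b /\ a = defining_sentence inf_form b).
  destruct (Halg e T) as [b [[Hb _] Heval]].
  - intros m. transitivity (In m (map form_code l) \/
                            eval (PComp ax alg) (prog_code e) m).
    { rewrite <- eval_table. split; intros [i H]; exists i; now apply He. }
    rewrite in_map_iff. split.
    + intros [[a [<- Ha]] | H].
      * exists a. split; [left; now apply Hl | reflexivity].
      * inversion H as [| | | | | f g x b y Hb Hm | | |]; subst.
        exists (defining_sentence inf_form b). split; [right; eauto |].
        exact (eval_functional _ _ _ _ Hm (Hax b)).
    + intros [a [[Ha | [b [Hb ->]]] ->]].
      * left. exists a. split; [reflexivity | now apply Hl].
      * right. now apply ev_comp with b.
  - intros a [Ha | [b [_ ->]]]; [now apply robinson_Q_sentence |].
    apply inf_sentence.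
  - assert (Hb : exists b, forall b', eval alg (prog_code e) b' -> b' = b).
    { destruct (classic (exists b, eval alg (prog_code e) b)) as [[b Hb] | Hno].
      - exists b. intros b' Hb'. exact (eval_functional _ _ _ _ Hb' Hb).
      (* If [alg] diverges, [T] is just [Q] and any value would do. *)
      - exists 0. intros b' Hb'. exfalso. eauto. }
    destruct Hb as [b Hb].
    apply (model_consistent (inf_model b) T (fun _ => None)).
    intros a [Ha | [b' [Hb' ->]]]; [now apply inf_model_Q |].
    rewrite (Hb b' Hb'). apply inf_model_defining.
  - now left.
  - apply Hb. exists inf_form. split; [apply len_inf_form |].
    apply prv_ax. right. eauto.
Qed.
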